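(* Let $R$ be a commutative ring and let $\mathcal{Q}$ be a normed PMQ which is maximally decomposable, coconnected and pairwise determined. Then the PMQ-ring $R[\mathcal{Q}]$, graded by the norm of $\mathcal{Q}$, is a quadratic $R$-algebra.
   Context: A quandle (with unit) is a set $\mathcal{Q}$ with an element $\mathbf{1}\in\mathcal{Q}$ (unit) and a binary operation $(a,b)\mapsto a^b$ (conjugation) such that: $(-)^a\colon\mathcal{Q}\to\mathcal{Q}$ is bijective for all $a$ (with inverse denoted $(-)^{a^{-1}}$); $\mathbf{1}^a=\mathbf{1}$ and $a^{\mathbf{1}}=a$; $a^a=a$; $(a^b)^c=(a^c)^{(b^c)}$ for all $a,b,c$. A partial monoid is a set $M$ with an element $\mathbf{1}$, a subset $D\subseteq M\times M$ and a map $D\to M$, $(a,b)\mapsto ab$ (one says $ab$ is defined if $(a,b)\in D$), such that $\mathbf{1}a$ and $a\mathbf{1}$ are defined and equal to $a$, and for all $a,b,c$: ($ab$ and $(ab)c$ are defined) if and only if ($bc$ and $a(bc)$ are defined), in which case $(ab)c=a(bc)$. A PMQ is a set $\mathcal{Q}$ that is both a quandle and a partial monoid with the same unit, such that for all $a,b,c$: (1) $ab$ is defined iff $b(a^b)$ is defined, and then $ab=b(a^b)$; (2) $a^{(bc)}=(a^b)^c$ whenever $bc$ is defined; (3) $ab$ is defined iff $(a^c)(b^c)$ is defined, and then $(ab)^c=(a^c)(b^c)$. A norm on $\mathcal{Q}$ is a map $N\colon\mathcal{Q}\to\mathbb{N}$ with $N(a^b)=N(a)$ for all $a,b$, $N(ab)=N(a)+N(b)$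 whenever $ab$ is defined, and $N^{-1}(0)=\{\mathbf{1}\}$; a normed PMQ is a PMQ endowed with a norm. Put $\mathcal{Q}_r=N^{-1}(r)$. A decomposition of $a\in\mathcal{Q}$ with respect to $\mathcal{Q}_1$ is a (possibly empty) sequence $(a_1,\dots,a_r)$ in $\mathcal{Q}_1$, with $r=N(a)$, such that $a_1\cdots a_r$ is defined in $\mathcal{Q}$ and equals $a$. A standard move on a sequence $(a_1,\dots,a_r)$ replaces, for some $1\le i\le r-1$, the consecutive entries $(a_i,a_{i+1})$ by $(a_{i+1},a_i^{a_{i+1}})$ or by $(a_{i+1}^{a_i^{-1}},a_i)$. $\mathcal{Q}$ is maximally decomposable if every $a\in\mathcal{Q}$ admits a decomposition with respect to $\mathcal{Q}_1$. It is coconnected if it is maximally decomposable and, for every $a\in\mathcal{Q}$, any two decompositions of $a$ with respect to $\mathcal{Q}_1$ are connected by a sequence of standard moves. A normed, maximally decomposable $\mathcal{Q}$ is pairwise determined if for every $r\ge3$ and every sequence $(a_1,\dots,a_r)$ in $\mathcal{Q}_1$, either the product $a_1\cdots a_r$ is defined in $\mathcal{Q}$, or some sequence of standard moves connects $(a_1,\dots,a_r)$ to a sequence $(a_1',\dots,a_r')$ such that $a_1'a_2'$ is not defined in $\mathcal{Q}$. The PMQ-ring $R[\mathcal{Q}]$ is the associative $R$-algebra that is free as an $R$-module on elements $[a]$, $a\in\mathcal{Q}$, with $[a][b]=[ab]$ if $ab$ is defined in $\mathcal{Q}$ and $[a][b]=0$ otherwise. If $\mathcal{Q}$ is normed, $R[\mathcal{Q}]$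 is graded, with $[a]$ in degree $N(a)$. A graded $R$-algebra $A$ is quadratic if its degree $1$ part $A_1$ is a free $R$-module and $A$ is the quotient of the tensor algebra $\bigoplus_{i\ge0}A_1^{\otimes i}$ (over $R$) by a two-sided ideal generated by elements of $A_1^{\otimes2}$. *)

(* Defs.v *)
From HB Require Import structures.
From mathcomp Require Import all_boot all_order all_algebra.
From mathcomp Require Import finmap generic_quotient boolp.
From mathcomp.multinomials Require Import monalg.
From Stdlib Require Import Relation_Operators.

Set Implicit Arguments.
Unset Strict Implicit.
Unset Printing Implicit Defensive.

Import GRing.Theory.

Local Open Scope fset_scope.
Local Open Scope ring_scope.
Local Open Scope quotient_scope.

(* The unit is a mixin of its own, so that the quandle and the partial monoid
   underlying a PMQ share it. *)
HB.mixin Record hasUnitElt T := { qone : T }.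
#[short(type="unitEltType")]
HB.structure Definition UnitElt := { T of Choice T & hasUnitElt T }.

(* pmul a b = None means that the product ab is not defined. As equations in
   option, pmulA and the like assert at once that both sides have the same
   domain of definition and the same value there. *)
HB.mixin Record isPartialMonoid T of UnitElt T := {
  pmul : T -> T -> option T;
  pmul1q : forall a : T, pmul qone a = Some a;
  pmulq1 : forall a : T, pmul a qone = Some a;
  pmulA : forall a b c : T,
    obind (fun ab => pmul ab c) (pmul a b) = obind (pmul a) (pmul b c)
}.
#[short(type="partialMonoidType")]
HB.structure Definition PartialMonoid :=
  { T of UnitElt T & isPartialMonoid T }.

(* conjq a b is a^b and conjqV a b is a^(b^-1). *)
HB.mixin Record isQuandle T of UnitElt T := {
  conjq : T -> T -> T;
  conjqV : T -> T -> T;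
  conjqK : forall b : T, cancel (conjq^~ b) (conjqV^~ b);
  conjqVK : forall b : T, cancel (conjqV^~ b) (conjq^~ b);
  conj1q : forall a : T, conjq qone a = qone;
  conjq1 : forall a : T, conjq a qone = a;
  conjqq : forall a : T, conjq a a = a;
  conjqJ : forall a b c : T,
    conjq (conjq a b) c = conjq (conjq a c) (conjq b c)
}.
#[short(type="quandleType")]
HB.structure Definition Quandle := { T of UnitElt T & isQuandle T }.

HB.mixin Record isPMQ T of PartialMonoid T & Quandle T := {
  pmulJ : forall a b : T, pmul a b = pmul b (conjq a b);
  conjqM : forall a b c bc : T,
    pmul b c = Some bc -> conjq a bc = conjq (conjq a b) c;
  conjMq : forall a b c : T,
    pmul (conjq a c) (conjq b c) = omap (conjq^~ c) (pmul a b)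
}.
#[short(type="pmqType")]
HB.structure Definition PMQ :=
  { T of PartialMonoid T & Quandle T & isPMQ T }.

HB.mixin Record hasPMQNorm T of PMQ T := {
  qnorm : T -> nat;
  qnormJ : forall a b : T, qnorm (conjq a b) = qnorm a;
  qnormM : forall a b ab : T,
    pmul a b = Some ab -> qnorm ab = (qnorm a + qnorm b)%N;
  qnorm_eq0 : forall a : T, qnorm a = 0%N <-> a = qone
}.
#[short(type="normedPMQType")]
HB.structure Definition NormedPMQ := { T of PMQ T & hasPMQNorm T }.

(* By pmulA, the bracketing used here is immaterial. *)
Definition pprod (M : partialMonoidType) (s : seq M) : option M :=
  foldr (fun a => obind (pmul a)) (Some qone) s.

Definition norm1_seq (Q : normedPMQType) (s : seq Q) : Prop :=
  forall x, x \in s -> qnorm x = 1%N.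

Definition decomposition (Q : normedPMQType) (a : Q) (s : seq Q) : Prop :=
  [/\ norm1_seq s, size s = qnorm a & pprod s = Some a].

Inductive standard_move (Q : quandleType) : seq Q -> seq Q -> Prop :=
| StandardMoveR s t a b :
    standard_move (s ++ [:: a, b & t]) (s ++ [:: b, conjq a b & t])
| StandardMoveL s t a b :
    standard_move (s ++ [:: a, b & t]) (s ++ [:: conjqV b a, a & t]).

(* The two kinds of moves are inverse to each other, so this relation is
   symmetric. *)
Definition move_connected (Q : quandleType) : seq Q -> seq Q -> Prop :=
  clos_refl_trans (seq Q) (@standard_move Q).

Definition maximally_decomposable (Q : normedPMQType) : Prop :=
  forall a : Q, exists s, decomposition a s.

Definition coconnected (Q : normedPMQType) : Prop :=
  maximally_decomposable Q /\
  forall (a : Q) (s t : seq Q),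
    decomposition a s -> decomposition a t -> move_connected s t.

Definition pairwise_determined (Q : normedPMQType) : Prop :=
  maximally_decomposable Q /\
  forall s : seq Q, (3 <= size s)%N -> norm1_seq s ->
    pprod s <> None \/
    exists (a b : Q) (t : seq Q),
      move_connected s [:: a, b & t] /\ pmul a b = None.

(* Unital associative R-algebras. MathComp's algType is not used because its
   carrier is a nonzero ring, which excludes every algebra over the zero ring;
   here R and A may be zero. *)
HB.mixin Record isAssocAlgebra (R : comPzRingType) A of GRing.Lmodule R A := {
  aone : A;
  amul : A -> A -> A;
  amulA : associative amul;
  amul1x : left_id aone amul;
  amulx1 : right_id aone amul;
  amull_linear : forall y : A, linear (amul^~ y);
  amulr_linear : forall x : A, linear (amul x)
}.
#[short(type="assocAlgType")]
HB.structure Definition AssocAlgebra (R : comPzRingType) :=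
  { A of GRing.Lmodule R A & isAssocAlgebra R A }.

Section AssocAlgebraTheory.
Variables (R : comPzRingType) (A : assocAlgType R).
Implicit Types x y z : A.

HB.instance Definition _ x :=
  GRing.isLinear.Build R A A *:%R (amul x) (amulr_linear x).

Definition amulr y x : A := amul x y.
HB.instance Definition _ y :=
  GRing.isLinear.Build R A A *:%R (amulr y) (amull_linear y).

Lemma amulDl z : {morph amul^~ z : x y / x + y}.
Proof. exact: (linearD (amulr z)). Qed.
Lemma amulDr x : {morph amul x : y z / y + z}.
Proof. exact: linearD. Qed.
Lemma amulBl z : {morph amul^~ z : x y / x - y}.
Proof. exact: (linearB (amulr z)). Qed.
Lemma amulBr x : {morph amul x : y z / y - z}.
Proof. exact: linearB. Qed.
Lemma amul0x x : amul 0 x = 0.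
Proof. exact: (linear0 (amulr x)). Qed.
Lemma amulx0 x : amul x 0 = 0.
Proof. exact: linear0. Qed.
Lemma amulZl c x y : amul (c *: x) y = c *: amul x y.
Proof. exact: (linearZ_LR (amulr y)). Qed.
Lemma amulZr c x y : amul x (c *: y) = c *: amul x y.
Proof. exact: linearZ_LR. Qed.
Lemma amul_suml I (r : seq I) P (F : I -> A) y :
  amul (\sum_(i <- r | P i) F i) y = \sum_(i <- r | P i) amul (F i) y.
Proof. exact: (linear_sum (amulr y)). Qed.
Lemma amul_sumr I (r : seq I) P (F : I -> A) x :
  amul x (\sum_(i <- r | P i) F i) = \sum_(i <- r | P i) amul x (F i).
Proof. exact: linear_sum. Qed.
End AssocAlgebraTheory.

Definition aprod (R : comPzRingType) (A : assocAlgType R) (s : seq A) : A :=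
  foldr amul aone s.

Definition alg_morphism (R : comPzRingType) (A B : assocAlgType R)
    (f : A -> B) : Prop :=
  [/\ linear f, f aone = aone & {morph f : x y / amul x y}].

(* The two-sided ideal generated by S; it is a submodule because
   c *: x = (c *: 1) x. *)
Inductive ideal_gen (R : comPzRingType) (A : assocAlgType R) (S : A -> Prop) :
    A -> Prop :=
| IdealGen x : S x -> ideal_gen S x
| Ideal0 : ideal_gen S 0
| IdealD x y : ideal_gen S x -> ideal_gen S y -> ideal_gen S (x + y)
| IdealMl a x : ideal_gen S x -> ideal_gen S (amul a x)
| IdealMr a x : ideal_gen S x -> ideal_gen S (amul x a).

Section AlgQuotient.
Variables (R : comPzRingType) (A : assocAlgType R) (S : A -> Prop).
Local Notation I := (ideal_gen S).

Lemma idealZ c x : I x -> I (c *: x).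
Proof. by move=> Ix; rewrite -[x]amul1x -amulZl; apply: IdealMl. Qed.
Lemma idealN x : I x -> I (- x).
Proof. by move=> Ix; rewrite -scaleN1r; apply: idealZ. Qed.

Definition ideal_eq : rel A := fun x y => `[< I (x - y) >].

Fact ideal_eq_equiv : equiv_class_of ideal_eq.
Proof.
split=> [x|x y|y x z].
- by apply/asboolP; rewrite subrr; apply: Ideal0.
- by apply/asboolP/asboolP=> /idealN; rewrite opprB.
- move=> /asboolP xy /asboolP yz; apply/asboolP.
  by rewrite -[x](subrK y) -addrA; apply: IdealD.
Qed.
Canonical ideal_equiv := EquivRelPack ideal_eq_equiv.

Definition alg_quot : Type := {eq_quot ideal_eq}.
HB.instance Definition _ : EqQuotient A ideal_eq alg_quot :=
  EqQuotient.on alg_quot.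
HB.instance Definition _ := Choice.on alg_quot.

Definition quot_pi (x : A) : alg_quot := \pi x.

Lemma quot_piP x y : quot_pi x = quot_pi y <-> I (x - y).
Proof.
by split=> [/eqmodP/asboolP //|Ixy]; apply/eqmodP/asboolP.
Qed.

Lemma quot_piK (q : alg_quot) : quot_pi (repr q) = q.
Proof. exact: reprK. Qed.

Lemma quot_ind (P : alg_quot -> Prop) :
  (forall x, P (quot_pi x)) -> forall q, P q.
Proof. by move=> h q; rewrite -(quot_piK q); apply: h. Qed.

Definition addquot (p q : alg_quot) := quot_pi (repr p + repr q).
Definition oppquot (p : alg_quot) := quot_pi (- repr p).
Definition scalequot (c : R) (p : alg_quot) := quot_pi (c *: repr p).
Definition mulquot (p q : alg_quot) := quot_pi (amul (repr p) (repr q)).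

Lemma repr_pi x : I (repr (quot_pi x) - x).
Proof. by apply/quot_piP; rewrite quot_piK. Qed.

Lemma addquotE x y : addquot (quot_pi x) (quot_pi y) = quot_pi (x + y).
Proof.
by apply/quot_piP; rewrite opprD addrACA; apply: IdealD; apply: repr_pi.
Qed.
Lemma oppquotE x : oppquot (quot_pi x) = quot_pi (- x).
Proof. by apply/quot_piP; rewrite -opprD; apply/idealN/repr_pi. Qed.
Lemma scalequotE c x : scalequot c (quot_pi x) = quot_pi (c *: x).
Proof. by apply/quot_piP; rewrite -scalerBr; apply/idealZ/repr_pi. Qed.
Lemma mulquotE x y : mulquot (quot_pi x) (quot_pi y) = quot_pi (amul x y).
Proof.
apply/quot_piP; set x' := repr _; set y' := repr _.
rewrite -[_ - _](subrKA (amul x' y)) -amulBr -amulBl.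
by apply: IdealD; [apply/IdealMl/repr_pi|apply/IdealMr/repr_pi].
Qed.

Fact addquotA : associative addquot.
Proof.
by do 3!elim/quot_ind=> ?; rewrite !addquotE addrA.
Qed.
Fact addquotC : commutative addquot.
Proof. by do 2!elim/quot_ind=> ?; rewrite !addquotE addrC. Qed.
Fact add0quot : left_id (quot_pi 0) addquot.
Proof. by elim/quot_ind=> ?; rewrite addquotE add0r. Qed.
Fact addNquot : left_inverse (quot_pi 0) oppquot addquot.
Proof. by elim/quot_ind=> ?; rewrite oppquotE addquotE addNr. Qed.
HB.instance Definition _ := GRing.isZmodule.Build alg_quot
  addquotA addquotC add0quot addNquot.

Fact scalequotA a b p : scalequot a (scalequot b p) = scalequot (a * b) p.
Proof. by elim/quot_ind: p => p; rewrite !scalequotE scalerA. Qed.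
Fact scale1quot : left_id 1 scalequot.
Proof. by elim/quot_ind=> ?; rewrite scalequotE scale1r. Qed.
Fact scalequotDr : right_distributive scalequot +%R.
Proof.
move=> c; elim/quot_ind=> x; elim/quot_ind=> y.
rewrite -[quot_pi x + _]/(addquot _ _) addquotE !scalequotE.
by rewrite [RHS]addquotE scalerDr.
Qed.
Fact scalequotDl p : {morph scalequot^~ p : a b / a + b}.
Proof.
by move=> a b; elim/quot_ind: p => p; rewrite !scalequotE [RHS]addquotE scalerDl.
Qed.
HB.instance Definition _ := GRing.Zmodule_isLmodule.Build R alg_quot
  scalequotA scale1quot scalequotDr scalequotDl.

Lemma quot_pi_linear : linear quot_pi.
Proof.
by move=> c x y; rewrite -[RHS]/(addquot (scalequot _ _) _) scalequotE addquotE.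
Qed.
HB.instance Definition _ :=
  GRing.isLinear.Build R A alg_quot *:%R quot_pi quot_pi_linear.

Fact mulquotA : associative mulquot.
Proof. by do 3!elim/quot_ind=> ?; rewrite !mulquotE amulA. Qed.
Fact mul1quot : left_id (quot_pi aone) mulquot.
Proof. by elim/quot_ind=> ?; rewrite mulquotE amul1x. Qed.
Fact mulquot1 : right_id (quot_pi aone) mulquot.
Proof. by elim/quot_ind=> ?; rewrite mulquotE amulx1. Qed.
Fact mulquot_linl q : linear (mulquot^~ q).
Proof.
elim/quot_ind: q => q c; elim/quot_ind=> x; elim/quot_ind=> y.
rewrite -[X in mulquot X]quot_pi_linear !mulquotE -quot_pi_linear.
by rewrite amulDl amulZl.
Qed.
Fact mulquot_linr p : linear (mulquot p).
Proof.
elim/quot_ind: p => p c; elim/quot_ind=> x; elim/quot_ind=> y.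
rewrite -[X in mulquot _ X]quot_pi_linear !mulquotE -quot_pi_linear.
by rewrite amulDr amulZr.
Qed.
HB.instance Definition _ := isAssocAlgebra.Build R alg_quot
  mulquotA mul1quot mulquot1 mulquot_linl mulquot_linr.

Lemma quot_piM x y : quot_pi (amul x y) = amul (quot_pi x) (quot_pi y).
Proof. exact/esym/mulquotE. Qed.

Lemma quot_pi_morph : alg_morphism quot_pi.
Proof. by split; [exact: quot_pi_linear | | exact: quot_piM]. Qed.

Lemma alg_quot_lift (B : assocAlgType R) (f : A -> B) :
    alg_morphism f -> (forall x, S x -> f x = 0) ->
  exists2 g : alg_quot -> B, alg_morphism g & forall x, g (quot_pi x) = f x.
Proof.
move=> [flin f1 fM] fS.
have fB x y : f (x - y) = f x - f y.
  by rewrite addrC -scaleN1r flin scaleN1r addrC.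
have f0 : f 0 = 0 by rewrite -(subrr 0) fB subrr.
have fI x : I x -> f x = 0.
  elim=> {x} [x /fS //|//|x y _ fx _ fy|a x _ fx|a x _ fx].
  - by rewrite -[x]scale1r flin fx fy scaler0 addr0.
  - by rewrite fM fx amulx0.
  - by rewrite fM fx amul0x.
have gE x : f (repr (quot_pi x)) = f x.
  by apply/eqP; rewrite -subr_eq0 -fB fI //; apply: repr_pi.
exists (fun q => f (repr q)) => //; split; rewrite ?gE //.
- move=> c; do 2!elim/quot_ind=> ?; rewrite -linearP !gE; exact: flin.
- by do 2!elim/quot_ind=> ?; rewrite -quot_piM !gE.
Qed.
End AlgQuotient.

(* The free R-module on K, its elements being the finitely supported functions
   K -> R. *)
Definition freemod (R : comPzRingType) (K : choiceType) : Type := {malg R[K]}.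

Section FreeModule.
Variables (R : comPzRingType) (K : choiceType).
Local Notation F := (freemod R K).

HB.instance Definition _ := GRing.Zmodule.on F.

Definition fcoef (k : K) (x : F) : R := mcoeff k x.
Definition fbase (k : K) : F := mkmalgU k 1.
Definition fscale (c : R) (x : F) : F := [malg k in msupp x => c * x@_k].

Lemma fcoef_inj (x y : F) : (forall k, fcoef k x = fcoef k y) -> x = y.
Proof. by move=> h; apply/malgP. Qed.

Lemma fcoefD k (x y : F) : fcoef k (x + y) = fcoef k x + fcoef k y.
Proof. exact: mcoeffD. Qed.

Lemma fscaleE c x k : fcoef k (fscale c x) = c * fcoef k x.
Proof. by rewrite /fcoef mcoeffE; case: msuppP => //; rewrite mulr0. Qed.

Fact fscaleA a b x : fscale a (fscale b x) = fscale (a * b) x.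
Proof. by apply: fcoef_inj => k; rewrite !fscaleE mulrA. Qed.
Fact fscale1 : left_id 1 fscale.
Proof. by move=> x; apply: fcoef_inj => k; rewrite fscaleE mul1r. Qed.
Fact fscaleDr : right_distributive fscale +%R.
Proof.
by move=> c x y; apply: fcoef_inj => k; rewrite !(fscaleE, fcoefD) mulrDr.
Qed.
Fact fscaleDl x : {morph fscale^~ x : a b / a + b}.
Proof.
by move=> a b; apply: fcoef_inj => k; rewrite !(fscaleE, fcoefD) mulrDl.
Qed.
HB.instance Definition _ := GRing.Zmodule_isLmodule.Build R F
  fscaleA fscale1 fscaleDr fscaleDl.

Lemma fcoefZ k c (x : F) : fcoef k (c *: x) = c * fcoef k x.
Proof. exact: fscaleE. Qed.

Lemma fcoefU k c k' : fcoef k' (c *: fbase k) = c *+ (k == k').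
Proof. by rewrite fcoefZ /fcoef mcoeffU mulrnAr mulr1. Qed.

Lemma scale_fbase c k : c *: fbase k = mkmalgU k c :> F.
Proof. by apply: fcoef_inj => k'; rewrite fcoefU /fcoef mcoeffU. Qed.

Section Extension.
Variables (V : lmodType R) (h : K -> V).

Definition flin (x : F) : V := \sum_(k <- msupp x) fcoef k x *: h k.

Lemma flinEw (D : {fset K}) (x : F) :
  msupp x `<=` D -> flin x = \sum_(k <- D) fcoef k x *: h k.
Proof.
move=> xD; rewrite /flin; apply: big_fset_incl => // k _.
by move/mcoeff_outdom; rewrite /fcoef => ->; rewrite scale0r.
Qed.

Lemma flin_is_linear : linear flin.
Proof.
move=> c x y; pose D := msupp (c *: x + y) `|` (msupp x `|` msupp y).
rewrite !(@flinEw D) /D; first last.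
- exact: fsubsetUl.
- by rewrite fsubsetU // fsubsetUl orbT.
- by rewrite fsubsetU // fsubsetUr orbT.
rewrite scaler_sumr -big_split /=; apply: eq_bigr => k _.
by rewrite fcoefD fcoefZ scalerDl scalerA.
Qed.
HB.instance Definition _ := GRing.isLinear.Build R F V *:%R flin flin_is_linear.

Lemma flin_base k : flin (fbase k) = h k.
Proof.
rewrite (@flinEw [fset k]) ?msuppU_le // big_seq_fset1.
by rewrite /fcoef mcoeffUU scale1r.
Qed.
End Extension.

Lemma fbaseE (x : F) : x = \sum_(k <- msupp x) fcoef k x *: fbase k.
Proof.
rewrite {1}[LHS]monalgE; apply: eq_bigr => k _; exact/esym/scale_fbase.
Qed.

Lemma flin_ext (V : lmodType R) (f g : {linear F -> V}) :
  (forall k, f (fbase k) = g (fbase k)) -> f =1 g.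
Proof.
move=> fg x; rewrite [x]fbaseE !linear_sum.
by apply: eq_bigr => k _; rewrite !linearZ fg.
Qed.
End FreeModule.

Section PMAlgebra.
Variables (R : comPzRingType) (M : partialMonoidType).
Local Notation F := (freemod R M).

Definition obase (o : option M) : F := oapp (@fbase R M) 0 o.

(* The bilinear product with [a][b] = [ab] if ab is defined, and 0 if not. *)
Definition fmulx (y : F) (a : M) : F :=
  flin (fun b => obase (pmul a b)) y.
Definition fmul (x y : F) : F := flin (fmulx y) x.

Lemma fmul_base a b : fmul (fbase R a) (fbase R b) = obase (pmul a b).
Proof. by rewrite /fmul flin_base /fmulx flin_base. Qed.

Lemma fmull_is_linear y : linear (fmul^~ y).
Proof. exact: flin_is_linear. Qed.
Lemma fmulr_is_linear x : linear (fmul x).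
Proof.
move=> c y z; rewrite /fmul /flin scaler_sumr -big_split; apply: eq_bigr.
move=> a _ /=; rewrite /fmulx linearP scalerDr !scalerA.
by rewrite [c * _]mulrC.
Qed.

HB.instance Definition _ x :=
  GRing.isLinear.Build R F F *:%R (fmul x) (fmulr_is_linear x).
Definition fmulr (y x : F) : F := fmul x y.
HB.instance Definition _ y :=
  GRing.isLinear.Build R F F *:%R (fmulr y) (fmull_is_linear y).

Fact fmulA : associative fmul.
Proof.
move=> x y z.
apply: (flin_ext (f := fmulr (fmul y z)) (g := fmulr z \o fmulr y)) => a.
rewrite /= /fmulr.
apply: (flin_ext (f := fmul (fbase R a) \o fmulr z)
                 (g := fmulr z \o fmul (fbase R a))) => b.
rewrite /= /fmulr.
apply: (flin_ext (f := fmul (fbase R a) \o fmul (fbase R b))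
                 (g := fmul (fmul (fbase R a) (fbase R b)))) => c.
rewrite /= !fmul_base.
have -> o : fmul (fbase R a) (obase o) = obase (obind (pmul a) o).
  by case: o => [d|] /=; rewrite ?fmul_base // linear0.
rewrite -pmulA; case: (pmul a b) => [d|] /=; first by rewrite fmul_base.
exact/esym/(linear0 (fmulr _)).
Qed.

Fact fmul1x : left_id (fbase R qone) fmul.
Proof.
move=> x; apply: (flin_ext (f := fmul _) (g := idfun)) => a.
by rewrite /= fmul_base pmul1q.
Qed.
Fact fmulx1 : right_id (fbase R qone) fmul.
Proof.
move=> x; apply: (flin_ext (f := fmulr _) (g := idfun)) => a.
by rewrite /= /fmulr fmul_base pmulq1.
Qed.
HB.instance Definition _ := isAssocAlgebra.Build R F
  fmulA fmul1x fmulx1 fmull_is_linear fmulr_is_linear.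

Lemma amul_base a b :
  amul (fbase R a) (fbase R b) = obase (pmul a b).
Proof. exact: fmul_base. Qed.
End PMAlgebra.

(* The free monoid on V, a partial monoid whose product is everywhere
   defined. *)
Definition word (V : choiceType) : Type := seq V.

Section Word.
Variable V : choiceType.
HB.instance Definition _ := Choice.on (word V).
HB.instance Definition _ := hasUnitElt.Build (word V) ([::] : seq V).

Definition wmul (s t : word V) : option (word V) := Some (s ++ t).

Fact wmul1q s : wmul qone s = Some s. Proof. by []. Qed.
Fact wmulq1 s : wmul s qone = Some s. Proof. by rewrite /wmul cats0. Qed.
Fact wmulA a b c :
  obind (fun ab => wmul ab c) (wmul a b) = obind (wmul a) (wmul b c).
Proof. by rewrite /= /wmul catA. Qed.
HB.instance Definition _ := isPartialMonoid.Build (word V) wmul1q wmulq1 wmulA.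
End Word.

(* The tensor algebra of V: the free R-algebra on the set V modulo the
   relations that make the insertion of V linear. *)
Section TensorAlgebra.
Variables (R : comPzRingType) (V : lmodType R).

Definition gen (v : V) : freemod R (word V) := fbase R ([:: v] : word V).

Definition linear_relation (x : freemod R (word V)) : Prop :=
  exists (c : R) (u v : V), x = gen (c *: u + v) - (c *: gen u + gen v).

Definition tensor_alg : Type := alg_quot linear_relation.
HB.instance Definition _ := AssocAlgebra.on tensor_alg.

Definition tensor_in (v : V) : tensor_alg := quot_pi linear_relation (gen v).

Lemma tensor_in_linear : linear tensor_in.
Proof.
move=> c u v; rewrite /tensor_in -[RHS]linearP; apply/quot_piP.
by apply: IdealGen; exists c, u, v.
Qed.

(* V^{(x) n} inside the tensor algebra: the span of the v1 (x) ... (x) vn. *)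
Definition tensor_power (n : nat) (x : tensor_alg) : Prop :=
  exists l : seq (R * n.-tuple V),
    x = \sum_(p <- l) p.1 *: aprod (map tensor_in p.2).

Lemma fbase_word (s : seq V) : fbase R (s : word V) = aprod (map gen s).
Proof.
elim: s => [//|v s IHs] /=; rewrite -IHs.
exact/esym/(amul_base R ([:: v] : word V) s).
Qed.

Lemma tensor_algP (B : assocAlgType R) (f : V -> B) : linear f ->
  exists g : tensor_alg -> B,
    [/\ alg_morphism g, forall v, g (tensor_in v) = f v
      & forall h : tensor_alg -> B, alg_morphism h ->
          (forall v, h (tensor_in v) = f v) -> h =1 g].
Proof.
move=> f_lin; pose F : freemod R (word V) -> B :=
    flin (fun s : word V => aprod (map f s)).
have Fbase (s : word V) : F (fbase R s) = aprod (map f s) by exact: flin_base.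
have Fmor : alg_morphism F.
  split; [exact: flin_is_linear|exact: Fbase|move=> x y].
  apply: (flin_ext (f := F \o fmulr y) (g := amulr (F y) \o F)) => a.
  rewrite /= /fmulr /amulr.
  apply: (flin_ext (f := F \o fmul _) (g := amul _ \o F)) => b.
  rewrite /= fmul_base -[obase _ _]/(fbase R (a ++ b : word V)).
  rewrite !flin_base map_cat.
  elim: (map f a) => [|u s IHs] /=; first by rewrite amul1x.
  by rewrite IHs amulA.
have Fgen v : F (gen v) = f v by rewrite Fbase /= amulx1.
have [|g g_mor gE] := alg_quot_lift Fmor (S := linear_relation).
  move=> _ [c [u [v ->]]]; rewrite /F linearB linearP /= /gen !flin_base.
  by rewrite /= !amulx1 f_lin subrr.
exists g; split=> // [v|h [h_lin h1 hM] hE]; first by rewrite -Fgen -gE.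
elim/quot_ind=> x; rewrite gE.
pose k (y : freemod R (word V)) := h (quot_pi linear_relation y).
have k_lin : linear k by move=> c y z; rewrite /k linearP h_lin.
pose k' : {linear freemod R (word V) -> B} :=
  HB.pack k (GRing.isLinear.Build R _ B *:%R k k_lin).
apply: (flin_ext (f := k') (g := flin _)) => s; rewrite /= flin_base /k fbase_word.
elim: s => [|v s IHs] /=; first exact: h1.
by rewrite quot_piM hM IHs hE.
Qed.
End TensorAlgebra.

Record gradedAlgType (R : comPzRingType) := GradedAlg {
  galg :> assocAlgType R;
  gpart : nat -> submodClosed galg;
  gpart1 : aone \in gpart 0;
  gpartM : forall i j x y,
    x \in gpart i -> y \in gpart j -> amul x y \in gpart (i + j);
  gpart_sum : forall x, exists n (s : nat -> galg),
    (forall i, s i \in gpart i) /\ x = \sum_(i < n) s i;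
  gpart_direct : forall n (s : nat -> galg),
    (forall i, s i \in gpart i) -> \sum_(i < n) s i = 0 ->
    forall i, (i < n)%N -> s i = 0
}.

Section GradedPiece.
Variables (R : comPzRingType) (A : gradedAlgType R) (n : nat).

Definition gpiece : Type := {x : A | x \in gpart A n}.
HB.instance Definition _ := SubChoice.on gpiece.
HB.instance Definition _ := [SubChoice_isSubLmodule of gpiece by <:].
End GradedPiece.

Definition is_free (R : comPzRingType) (V : lmodType R) : Prop :=
  exists (K : choiceType) (f : {linear freemod R K -> V}), bijective f.

(* The isomorphism with the quotient of the tensor algebra of A_1 is required
   to be the identity on A_1, that is, to be the one induced by the inclusion
   of A_1 in A. It is then automatically compatible with the gradings. *)
Definition quadratic (R : comPzRingType) (A : gradedAlgType R) : Prop :=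
  is_free (gpiece A 1) /\
  exists S : tensor_alg (gpiece A 1) -> Prop,
    (forall x, S x -> tensor_power 2 x) /\
    exists f : alg_quot S -> A,
      [/\ alg_morphism f, bijective f
        & forall x : gpiece A 1, f (quot_pi S (tensor_in x)) = \val x].

Section PMQRing.
Variables (R : comPzRingType) (Q : normedPMQType).
Local Notation RQ := (freemod R Q).

(* The span of the [a] with qnorm a = n. *)
Definition norm_part (n : nat) : {pred RQ} :=
  [pred x : RQ | all (fun a => qnorm a == n) (msupp x)].

Lemma norm_partP n x :
  reflect (forall a, fcoef a x != 0 -> qnorm a = n) (x \in norm_part n).
Proof.
apply: (iffP allP) => h a; first by rewrite mcoeff_neq0 => /h/eqP.
by rewrite -mcoeff_neq0 => /h/eqP.
Qed.

Fact norm_part_submod n : submod_closed (norm_part n).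
Proof.
split=> [|c x y /norm_partP hx /norm_partP hy].
  by apply/norm_partP=> a; rewrite /fcoef mcoeff0 eqxx.
apply/norm_partP=> a; rewrite fcoefD fcoefZ.
have [->|/hx //] := eqVneq (fcoef a x) 0.
by rewrite mulr0 add0r; apply: hy.
Qed.
HB.instance Definition _ n :=
  GRing.isSubmodClosed.Build R RQ (norm_part n) (norm_part_submod n).

Lemma norm_part_base a : fbase R a \in norm_part (qnorm a).
Proof.
apply/norm_partP=> b; rewrite /fcoef mcoeffU.
by case: (eqVneq a b) => [->|_]; rewrite ?mulr0n ?eqxx.
Qed.

Fact norm_part1 : aone \in norm_part 0.
Proof. by have := norm_part_base qone; rewrite (qnorm_eq0 _).2. Qed.

Fact norm_partM i j x y : x \in norm_part i -> y \in norm_part j ->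
  amul x y \in norm_part (i + j).
Proof.
move=> /allP hx /allP hy; rewrite [x]fbaseE [y]fbaseE.
rewrite amul_suml big_seq; apply: rpred_sum => a.
move=> /hx/eqP <-; rewrite amul_sumr big_seq; apply: rpred_sum => b.
move=> /hy/eqP <-; rewrite amulZl amulZr amul_base; do 2!apply: rpredZ.
case E: (pmul a b) => [c|] /=; last exact: rpred0.
by rewrite -(qnormM _ _ _ E) norm_part_base.
Qed.

Definition norm_comp (x : RQ) (i : nat) : RQ :=
  \sum_(a <- msupp x | qnorm a == i) fcoef a x *: fbase R a.

Fact norm_part_sum x : exists n (s : nat -> RQ),
  (forall i, s i \in norm_part i) /\ x = \sum_(i < n) s i.
Proof.
pose n := (\max_(a <- msupp x) qnorm a).+1.
exists n, (norm_comp x); split=> [i|].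
  by apply: rpred_sum => a /eqP <-; apply/rpredZ/norm_part_base.
rewrite /norm_comp (exchange_big_dep xpredT) //= {1}[x]fbaseE.
rewrite big_seq [RHS]big_seq; apply: eq_bigr => a xa.
have an : (qnorm a < n)%N by rewrite ltnS; apply: leq_bigmax_seq.
by rewrite (big_pred1 (Ordinal an)).
Qed.

Fact norm_part_direct n (s : nat -> RQ) :
  (forall i, s i \in norm_part i) -> \sum_(i < n) s i = 0 ->
  forall i, (i < n)%N -> s i = 0.
Proof.
move=> hs s0 i lt_in; apply: fcoef_inj => a; rewrite [RHS]mcoeff0.
have [//|nz] := eqVneq (fcoef a (s i)) 0.
have /norm_partP/(_ a nz) ai := hs i.
have := congr1 (fcoef a) s0; rewrite /fcoef raddf_sum mcoeff0 /=.
rewrite (bigD1 (Ordinal lt_in)) //= big1 ?addr0 // => j /eqP ne_ji.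
apply/eqP/negPn/negP => /(norm_partP _ _ (hs j)); rewrite ai => ij.
by apply: ne_ji; apply/val_inj.
Qed.

Definition PMQ_ring : gradedAlgType R :=
  @GradedAlg R RQ (fun n => GRing.SubmodClosed.clone _ _ (norm_part n) _)
    norm_part1 norm_partM norm_part_sum norm_part_direct.
End PMQRing.

(* Main.v *)
(* Let S consist of the elements of A_1 (x) A_1 killed by the canonical map from
   the tensor algebra to A = R[Q], and let e(a) be the class of a in Q_1 modulo
   S. The inverse of the map induced on the quotient sends [a] to
   e(a_1) ... e(a_r) for any decomposition of a. As e(a)e(b) = e(b)e(a^b), this
   product is invariant under standard moves, so coconnectedness makes it
   independent of the decomposition. It is multiplicative because, by pairwise
   determinacy, a sequence whose product is undefined can be moved to one that
   starts with a factor e(a)e(b) = 0. *)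
Require Import Defs.
From HB Require Import structures.
From mathcomp Require Import all_boot all_order all_algebra.
From mathcomp Require Import finmap boolp.
From mathcomp.multinomials Require Import monalg.

Set Implicit Arguments.
Unset Strict Implicit.
Unset Printing Implicit Defensive.

Import GRing.Theory.

Local Open Scope ring_scope.

(** * Products and morphisms of associative algebras *)

Lemma aprod_cat (R : comPzRingType) (A : assocAlgType R) (s t : seq A) :
  aprod (s ++ t) = amul (aprod s) (aprod t).
Proof. by elim: s => [|x s IHs] /=; rewrite ?amul1x // IHs amulA. Qed.

(** With [tensor_in] for [t], this places a two-term relation between products of generators in
    [tensor_power 2]. *)
Lemma sum_aprod2 (R : comPzRingType) (V : Type) (A : assocAlgType R)
    (t : V -> A) (c : R) (u v u' v' : V) :
  amul (t u) (t v) - c *: amul (t u') (t v') =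
  \sum_(p <- [:: (1, [tuple u; v]); (- c, [tuple u'; v'])])
     p.1 *: aprod (map t p.2).
Proof. by rewrite !big_cons big_nil /= !amulx1 scale1r scaleNr addr0. Qed.

Lemma alg_morphism_aprod (R : comPzRingType) (A B : assocAlgType R)
    (f : A -> B) (s : seq A) :
  alg_morphism f -> f (aprod s) = aprod (map f s).
Proof. by case=> _ f1 fM; elim: s => [//|x s IHs] /=; rewrite fM IHs. Qed.

Lemma alg_morphism_comp (R : comPzRingType) (A B C : assocAlgType R)
    (f : A -> B) (g : B -> C) :
  alg_morphism f -> alg_morphism g -> alg_morphism (g \o f).
Proof.
move=> [flin f1 fM] [glin g1 gM]; split=> [c x y||x y] /=.
- by rewrite flin glin.
- by rewrite f1 g1.
- by rewrite fM gM.
Qed.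

Lemma alg_morphismBZ (R : comPzRingType) (A B : assocAlgType R) (f : A -> B)
    (c : R) (x y x' y' : A) :
  alg_morphism f -> f (amul x y - c *: amul x' y') =
  amul (f x) (f y) - c *: amul (f x') (f y').
Proof. by case=> flin _ fM; rewrite addrC -scaleNr flin !fM scaleNr addrC. Qed.

Lemma quot_pi_rel (R : comPzRingType) (A : assocAlgType R) (S : A -> Prop)
    (c : R) (x y x' y' : A) :
  S (amul x y - c *: amul x' y') ->
  amul (quot_pi S x) (quot_pi S y) = c *: amul (quot_pi S x') (quot_pi S y').
Proof.
by move=> Sxy; rewrite -!quot_piM -linearZ; apply/quot_piP/IdealGen.
Qed.

(** * Products of sequences in [Q] and in its ring *)

Lemma pprod_cat (M : partialMonoidType) (s t : seq M) :
  pprod (s ++ t) = obind (fun a => obind (pmul a) (pprod t)) (pprod s).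
Proof.
elim: s => [|x s IHs] /=; first by case: (pprod t) => //= a; rewrite pmul1q.
rewrite IHs; case: (pprod s) => [a|] //=.
case: (pprod t) => [b|] /=; first by rewrite -pmulA.
by case: (pmul x a).
Qed.

Lemma aprod_fbase (R : comPzRingType) (M : partialMonoidType) (s : seq M) :
  aprod (map (@fbase R M) s) = obase R (pprod s).
Proof.
elim: s => [//|a s IHs] /=; rewrite IHs.
by case: (pprod s) => [b|] /=; rewrite ?amul_base ?amulx0.
Qed.

Lemma norm1_move (Q : normedPMQType) (s t : seq Q) :
  standard_move s t -> norm1_seq s -> norm1_seq t.
Proof.
have catP (u v : seq Q) :
    norm1_seq (u ++ v) <-> norm1_seq u /\ norm1_seq v.
  split=> [h|[hu hv] x]; last by rewrite mem_cat => /orP[/hu|/hv].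
  by split=> x xu; apply: h; rewrite mem_cat xu ?orbT.
have consP (a : Q) (u : seq Q) :
    norm1_seq (a :: u) <-> qnorm a = 1%N /\ norm1_seq u.
  split=> [h|[ha hu] x]; last by rewrite inE => /predU1P[->//|/hu].
  by split=> [|x xu]; apply: h; rewrite inE ?eqxx ?xu ?orbT.
case=> u v a b /catP[hu /consP[ha /consP[hb hv]]]; apply/catP; split=> //.
  by apply/consP; split=> //; apply/consP; rewrite qnormJ.
(* The norm of [conjqV b a] is found by conjugating back by [a], which gives [b]. *)
by apply/consP; rewrite -(qnormJ _ a) conjqVK; split=> //; apply/consP.
Qed.

(** A decomposition of [a] writes its basis element as a product of basis elements of norm one, so
    these generate the algebra. *)
Lemma PMQ_ring_ext (R : comPzRingType) (Q : normedPMQType)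
    (B : assocAlgType R) (f g : PMQ_ring R Q -> B) :
  maximally_decomposable Q -> alg_morphism f -> alg_morphism g ->
  (forall a : Q, qnorm a = 1%N -> f (fbase R a) = g (fbase R a)) -> f =1 g.
Proof.
move=> mdQ f_mor g_mor fg.
have [flin _ _] := f_mor; have [glin _ _] := g_mor.
pose f' : {linear freemod R Q -> B} :=
  HB.pack f (GRing.isLinear.Build R _ B *:%R f flin).
pose g' : {linear freemod R Q -> B} :=
  HB.pack g (GRing.isLinear.Build R _ B *:%R g glin).
apply: (flin_ext (f := f') (g := g')) => a /=.
have [s [s1 _ sE]] := mdQ a.
rewrite -[fbase R a]/(obase R (Some a)) -sE -aprod_fbase.
rewrite (alg_morphism_aprod _ f_mor) (alg_morphism_aprod _ g_mor) -!map_comp.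
by congr aprod; apply/eq_in_map=> b /s1; apply: fg.
Qed.

(** * Extending a map on elements of norm one to an algebra morphism *)

Section Presentation.
Variables (R : comPzRingType) (Q : normedPMQType).
Variables (B : assocAlgType R) (e : Q -> B).
Hypothesis eJ : forall a b : Q, qnorm a = 1%N -> qnorm b = 1%N ->
  amul (e a) (e b) = amul (e b) (e (conjq a b)).

Lemma aprod_move (s t : seq Q) : standard_move s t -> norm1_seq s ->
  aprod (map e s) = aprod (map e t).
Proof.
case=> u v a b s1; rewrite !map_cat !aprod_cat /= !amulA -!(amulA (aprod _)).
  by rewrite -eJ //; apply: s1; rewrite mem_cat !inE eqxx !orbT.
have a1 : qnorm a = 1%N by apply: s1; rewrite mem_cat !inE eqxx !orbT.
have b1 : qnorm b = 1%N by apply: s1; rewrite mem_cat !inE eqxx !orbT.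
(* A left move is a right move read backwards: [eJ] is used for [conjqV b a] and [a]. *)
by rewrite (eJ _ a1) ?conjqVK // -(qnormJ _ a) conjqVK.
Qed.

Lemma aprod_move_connected (s t : seq Q) : move_connected s t -> norm1_seq s ->
  aprod (map e s) = aprod (map e t) /\ norm1_seq t.
Proof.
elim=> {s t} [s t st s1|s //|s t u _ IHst _ IHtu s1].
  by split; [exact: aprod_move|exact: norm1_move st s1].
by have [-> t1] := IHst s1; apply: IHtu.
Qed.

Hypothesis pdQ : pairwise_determined Q.
Hypothesis e0 : forall a b : Q, qnorm a = 1%N -> qnorm b = 1%N ->
  pmul a b = None -> amul (e a) (e b) = 0.

(** Pairwise determinacy only speaks of length at least 3. Products of length at most one are always
    defined, and length two is [e0] itself. *)
Lemma aprod_undefined (s : seq Q) :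
  norm1_seq s -> pprod s = None -> aprod (map e s) = 0.
Proof.
have e0t a b t : norm1_seq [:: a, b & t] -> pmul a b = None ->
    aprod (map e [:: a, b & t]) = 0.
  move=> s1 ab; rewrite /= amulA e0 ?amul0x //; apply: s1;
  by rewrite !inE eqxx ?orbT.
case: s => [|a [|b [|c s]]] s1; first by [].
- by rewrite /= pmulq1.
- by rewrite [pprod _]/= pmulq1; apply: e0t.
- move=> sN; case: (pdQ.2 _ _ s1) => // [[a' [b' [t [st ab']]]]].
  by have [-> t1] := aprod_move_connected st s1; apply: e0t.
Qed.

Hypothesis ccQ : coconnected Q.

(** Existence half of a presentation by elements of norm one subject to the relations [eJ] and [e0];
    [PMQ_ring_ext] is the uniqueness half. *)
Lemma PMQ_ring_lift : exists h : PMQ_ring R Q -> B,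
  alg_morphism h /\ forall a : Q, qnorm a = 1%N -> h (fbase R a) = e a.
Proof.
(* [d] picks one decomposition of each element; [hE] shows that the choice does not affect [h]. *)
have [d dP] := choice ccQ.1.
have d1 a : norm1_seq (d a) by have [] := dP a.
have dE a : pprod (d a) = Some a by have [] := dP a.
have size_d a : size (d a) = qnorm a by have [] := dP a.
pose h : {linear freemod R Q -> B} := flin (fun a => aprod (map e (d a))).
have hE a s : decomposition a s -> h (fbase R a) = aprod (map e s).
  move=> sP; rewrite /= flin_base.
  by have [] := aprod_move_connected (ccQ.2 _ _ _ (dP a) sP) (d1 a).
exists h; split=> [|a a1]; last first.
  rewrite (hE a [:: a]) /= ?amulx1 //; split; rewrite ?a1 //= ?pmulq1 //.
  by move=> x; rewrite inE => /eqP->.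
split; first exact: flin_is_linear.
  by rewrite (hE _ [::]) //; split; rewrite //= (qnorm_eq0 _).2.
move=> x y; apply: (flin_ext (f := h \o fmulr y) (g := amulr (h y) \o h)) => a.
rewrite /= /fmulr /amulr.
apply: (flin_ext (f := h \o fmul _) (g := amul _ \o h)) => b.
rewrite /= fmul_base (hE _ _ (dP a)) (hE _ _ (dP b)) -aprod_cat -map_cat.
(* If [pmul a b] is defined, [d a ++ d b] decomposes it, its length being right by additivity of the
   norm; if not, [aprod_undefined] applies. *)
have ab1 : norm1_seq (d a ++ d b) by move=> z; rewrite mem_cat => /orP[/d1|/d1].
have abE : pprod (d a ++ d b) = pmul a b by rewrite pprod_cat !dE.
case: (pmul a b) abE (@qnormM _ a b) => [c|] abE qM /=; last first.
  by rewrite aprod_undefined // linear0.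
by apply: hE; split; rewrite // size_cat (qM c) // !size_d.
Qed.
End Presentation.

(** * The degree one part and the quadratic presentation *)

Section PMQRingQuadratic.
Variables (R : comPzRingType) (Q : normedPMQType).
Local Notation A := (PMQ_ring R Q).
Local Notation V := (gpiece A 1).

(** Made total by the default value 0 on elements of norm other than 1. *)
Definition base1 (a : Q) : V := insubd 0 (fbase R a : A).

Lemma val_base1 (a : Q) : qnorm a = 1%N -> \val (base1 a) = fbase R a.
Proof. by move=> a1; rewrite insubdK // -a1; apply: norm_part_base. Qed.

Lemma gpiece1E (x : V) :
  x = \sum_(a <- msupp (\val x)) fcoef a (\val x) *: base1 a.
Proof.
apply: val_inj; rewrite (linear_sum (\val : {linear V -> A})) /=.
rewrite {1}[LHS]fbaseE big_seq [RHS]big_seq; apply: eq_bigr => a xa.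
rewrite -[RHS]/(fcoef a (\val x) *: \val (base1 a)) val_base1 //.
by have /allP/(_ _ xa)/eqP := valP x.
Qed.

Lemma gpiece1_ext (W : lmodType R) (f g : V -> W) : linear f -> linear g ->
  (forall a : Q, qnorm a = 1%N -> f (base1 a) = g (base1 a)) -> f =1 g.
Proof.
move=> flin glin fg x.
pose f' : {linear V -> W} := HB.pack f (GRing.isLinear.Build R V W *:%R f flin).
pose g' : {linear V -> W} := HB.pack g (GRing.isLinear.Build R V W *:%R g glin).
change (f' x = g' x); rewrite [x]gpiece1E !linear_sum big_seq [RHS]big_seq.
apply: eq_bigr => a xa; rewrite !linearZ /= fg //.
by have /allP/(_ _ xa)/eqP := valP x.
Qed.

Lemma is_free_gpiece1 : is_free V.
Proof.
pose K : choiceType := {a : Q | qnorm a == 1%N}.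
pose f : {linear freemod R K -> V} := flin (fun k : K => base1 (val k)).
(* Projection onto the coordinates of norm one: [insub] fails on every other [a], which is sent to
   0. *)
pose g : {linear freemod R Q -> freemod R K} :=
  flin (fun a => oapp (@fbase R K) 0 (insub a)).
exists K, f; exists (fun x : V => g (\val x)) => x.
  apply: (flin_ext (f := g \o (\val : V -> A) \o f) (g := idfun)) => k.
  by rewrite /= flin_base val_base1 ?flin_base ?valK //; apply/eqP/(valP k).
rewrite [RHS]gpiece1E [g _]/(flin _ _) linear_sum /= big_seq [RHS]big_seq.
apply: eq_bigr => a xa; rewrite linearZ /=.
have /allP/(_ _ xa) a1 := valP x.
by rewrite insubT /= flin_base.
Qed.

(* Rewriting with equations on tensor_in makes unification unfold the quotients,
   which does not terminate in practice; hence the explicit equality terms. *)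
Lemma PMQ_ring_quadratic :
  coconnected Q -> pairwise_determined Q -> quadratic A.
Proof.
move=> ccQ pdQ; split; first exact: is_free_gpiece1.
have [g [g_mor gE _]] := tensor_algP (B := A) (f := \val : V -> A) (linearP _).
(* Relations are taken inside the kernel of [g], so [f] exists at once; the work lies in inverting
   it. *)
pose S (x : tensor_alg V) := tensor_power 2 x /\ g x = 0.
have [f f_mor fE] := alg_quot_lift g_mor (S := S) (fun x => @proj2 _ _).
exists S; split=> [x []//|]; exists f.
pose e (a : Q) := quot_pi S (tensor_in (base1 a)).
have g2 a b : qnorm a = 1%N -> qnorm b = 1%N ->
    amul (g (tensor_in (base1 a))) (g (tensor_in (base1 b))) =
    obase R (pmul a b).
  move=> a1 b1; rewrite -amul_base -(val_base1 a1) -(val_base1 b1).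
  exact: congr2 (gE _) (gE _).
(* The scalar serves both kinds of relation: [c = 1] gives [eJ] and [c = 0] gives [e0]. *)
have e_rel c a b a' b' : qnorm a = 1%N -> qnorm b = 1%N ->
    qnorm a' = 1%N -> qnorm b' = 1%N ->
    obase R (pmul a b) = c *: obase R (pmul a' b') ->
    amul (e a) (e b) = c *: amul (e a') (e b').
  move=> a1 b1 a'1 b'1 ab; apply: quot_pi_rel; split; last first.
    apply: etrans (alg_morphismBZ _ _ _ _ _ g_mor) _.
    have := congr2 (fun x y => x - c *: y) (g2 _ _ a1 b1) (g2 _ _ a'1 b'1).
    by move=> gE2; apply: etrans gE2 _; rewrite ab subrr.
  exists [:: (1, [tuple base1 a; base1 b]); (- c, [tuple base1 a'; base1 b'])].
  exact: sum_aprod2.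
have eJ a b : qnorm a = 1%N -> qnorm b = 1%N ->
    amul (e a) (e b) = amul (e b) (e (conjq a b)).
  move=> a1 b1; rewrite -[RHS]scale1r.
  by apply: e_rel; rewrite ?qnormJ // -pmulJ scale1r.
have e0 a b : qnorm a = 1%N -> qnorm b = 1%N -> pmul a b = None ->
    amul (e a) (e b) = 0.
  move=> a1 b1 ab; rewrite -[RHS](scale0r (amul (e a) (e b))).
  by apply: e_rel; rewrite // ab scaler0.
have [h [h_mor hE]] := PMQ_ring_lift eJ pdQ e0 ccQ.
have hgE (v : V) : h (g (tensor_in v)) = quot_pi S (tensor_in v).
  rewrite gE; move: v; apply: gpiece1_ext => [c u v|c u v|a a1].
  - by case: h_mor => hlin _ _; apply: hlin.
  - by rewrite tensor_in_linear quot_pi_linear.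
  - by rewrite val_base1 // hE.
(* Both morphisms equal the unique extension of their common restriction to [V]. *)
have tensor_ext (k l : tensor_alg V -> alg_quot S) :
    alg_morphism k -> alg_morphism l ->
    (forall v, k (tensor_in v) = l (tensor_in v)) -> k =1 l.
  move=> k_mor l_mor kl x.
  have l_lin : linear (fun v : V => l (tensor_in v)).
    by case: l_mor => llin _ _ c u v; rewrite tensor_in_linear llin.
  have [m [_ _ m_uniq]] := tensor_algP l_lin.
  by apply: etrans (m_uniq _ k_mor kl x) _; apply/esym/(m_uniq _ l_mor).
split=> // [|v]; last exact: etrans (fE _) (gE _).
exists h => [|x].
  (* [h] after [f] is the identity: on the tensor algebra, [h \o g] and the projection agree on [V]
     by [hgE]. *)
  apply: quot_ind => x; apply: etrans (congr1 h (fE x)) _.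
  apply: (tensor_ext (h \o g)) => //; last exact: quot_pi_morph.
  exact: alg_morphism_comp g_mor h_mor.
(* [f] after [h] is the identity, as it fixes the basis elements of norm one. *)
apply: (PMQ_ring_ext (f := f \o h) (g := idfun)) ccQ.1 _ _ _ x => //.
  exact: alg_morphism_comp h_mor f_mor.
move=> a a1; apply: etrans (congr1 f (hE a a1)) _.
by apply: etrans (fE _) _; apply: etrans (gE _) _; apply: val_base1.
Qed.
End PMQRingQuadratic.

Theorem theorem4 (R : comPzRingType) (Q : normedPMQType) :
  maximally_decomposable Q -> coconnected Q -> pairwise_determined Q ->
  quadratic (PMQ_ring R Q).
Proof. by move=> _; apply: PMQ_ring_quadratic. Qed.
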